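(* For any fixed $k\in(0,1)$, the problem $\mathrm{M}^\star(n,n^k,n\mid n^{1-k})$ can be reduced in $O(n^2)$ time to APSP in a directed unweighted graph with $O(n)$ vertices: i.e., given the input matrices, one can in $O(n^2)$ time build a directed unweighted graph with $O(n)$ vertices such that the Min-Plus product can be read off (in $O(n^2)$ time) from its all-pairs shortest-path distances.
   Context: $\mathrm{M}^\star(n_1,n_2,n_3\mid M)$: compute the Min-Plus product $C[i,j]=\min_k(A[i,k]+B[k,j])$ of an $n_1\times n_2$ matrix $A$ and an $n_2\times n_3$ matrix $B$ with integer entries in $\{0,\dots,M\}$. APSP: compute all pairwise shortest-path distances. *)

(* Defs.v *)
From HB Require Import structures.
From mathcomp Require Export all_boot all_order all_algebra.
From mathcomp Require Export reals exp.

Set Implicit Arguments.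
Unset Strict Implicit.
Unset Printing Implicit Defensive.

(** * Word RAM *)

(* A unit-cost word RAM with finitely many registers used by each program, a
   random access memory, and structured control flow.  A word is a natural
   number smaller than [W].  A computation whose result is not a word is stuck
   (instead of wrapping around), so that a program that runs to completion for
   [W] also does so, identically, for every larger word bound. *)

Variant binop := Add | Sub | Mul.

Definition eval_op (o : binop) : nat -> nat -> nat :=
  match o with Add => addn | Sub => subn | Mul => muln end.

Inductive prog :=
| Skip
| Const of nat & nat              (* Const d v : reg d := v *)
| Op of binop & nat & nat & nat   (* Op o d a b : reg d := reg a `o` reg b *)
| Get of nat & nat                (* Get d a : reg d := mem (reg a) *)
| Put of nat & nat                (* Put a b : mem (reg a) := reg b *)
| Seq of prog & prog
| IfLt of nat & nat & prog & prog (* IfLt a b p q : branch on reg a < reg b *)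
| WhileLt of nat & nat & prog.    (* WhileLt a b p : loop while reg a < reg b *)

Record state := State { reg : nat -> nat; mem : nat -> nat }.

Definition set_reg (s : state) (d v : nat) : state :=
  State [eta reg s with d |-> v] (mem s).

Definition set_mem (s : state) (a v : nat) : state :=
  State (reg s) [eta mem s with a |-> v].

(* [exec W p s t s'] : with word bound [W], program [p] started in state [s]
   halts in state [s'] after exactly [t] unit-cost steps. *)
Inductive exec (W : nat) : prog -> state -> nat -> state -> Prop :=
| ExecSkip s : exec W Skip s 1 s
| ExecConst d v s : v < W -> exec W (Const d v) s 1 (set_reg s d v)
| ExecOp o d a b s :
    eval_op o (reg s a) (reg s b) < W ->
    exec W (Op o d a b) s 1 (set_reg s d (eval_op o (reg s a) (reg s b)))
| ExecGet d a s : exec W (Get d a) s 1 (set_reg s d (mem s (reg s a)))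
| ExecPut a b s : exec W (Put a b) s 1 (set_mem s (reg s a) (reg s b))
| ExecSeq p q s1 t1 s2 t2 s3 :
    exec W p s1 t1 s2 -> exec W q s2 t2 s3 ->
    exec W (Seq p q) s1 (t1 + t2) s3
| ExecIfT a b p q s t s' :
    reg s a < reg s b -> exec W p s t s' -> exec W (IfLt a b p q) s t.+1 s'
| ExecIfF a b p q s t s' :
    ~~ (reg s a < reg s b) -> exec W q s t s' -> exec W (IfLt a b p q) s t.+1 s'
| ExecWhileT a b p s1 t1 s2 t2 s3 :
    reg s1 a < reg s1 b -> exec W p s1 t1 s2 ->
    exec W (WhileLt a b p) s2 t2 s3 ->
    exec W (WhileLt a b p) s1 (t1 + t2).+1 s3
| ExecWhileF a b p s :
    ~~ (reg s a < reg s b) -> exec W (WhileLt a b p) s 1 s.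

Lemma exec_det W p s t1 s1 t2 s2 :
  exec W p s t1 s1 -> exec W p s t2 s2 -> t1 = t2 /\ s1 = s2.
Proof.
move=> E; elim: E t2 s2 => {p s t1 s1}; intros.
all: match goal with
     | E : exec _ ?p _ ?t ?s |- _ = ?t /\ _ = ?s => inversion E; subst
     end.
all: try by [].
all: try match goal with
     | H : is_true ?b, H' : is_true (~~ ?b) |- _ => by rewrite H in H'
     end.
all: repeat match goal with
     | IH : (forall t s, exec _ ?p ?s1 t s -> _), E : exec _ ?p ?s1 _ _ |- _ =>
         case: (IH _ _ E) => ? ?; subst; clear IH
     end; by [].
Qed.

(* The input occupies the memory from address 0 on; all other cells and all
   registers are initially 0. *)
Definition init (inp : seq nat) : state := State (fun=> 0) (nth 0 inp).

(* On input [inp], [p] halts within [t] steps, leaving in register 0 the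
   address of a memory block that contains [out].  Input and output have to fit
   in the memory addressable with words, and the input has to consist of
   words. *)
Definition computes (W : nat) (p : prog) (inp out : seq nat) (t : nat) : Prop :=
  [/\ all (fun x => x < W) inp, size inp <= W &
    exists t' s,
      [/\ t' <= t, exec W p (init inp) t' s, reg s 0 + size out <= W &
          forall i, i < size out -> mem s (reg s 0 + i) = nth 0 out i]].

(* Words of [c * l] bits, where [l] is the length of [n] in binary. *)
Definition word_bound (c n : nat) : nat := 2 ^ (c * (trunc_log 2 n).+1).

(** * Distances in directed unweighted graphs *)

Definition walk (T : finType) (e : rel T) (u v : T) (m : nat) : bool :=
  [exists p : m.-tuple T, path e u p && (last u p == v)].

Lemma connect_walk (T : finType) (e : rel T) (u v : T) :
  connect e u v -> exists m, walk e u v m.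
Proof.
case/connectP=> p pth ->; exists (size p).
by apply/existsP; exists (in_tuple p); rewrite pth /=.
Qed.

(* The least length of a walk from [u] to [v], [None] standing for infinity. *)
Definition dist (T : finType) (e : rel T) (u v : T) : option nat :=
  match @idP (connect e u v) with
  | ReflectT uv => Some (ex_minn (connect_walk uv))
  | ReflectF _ => None
  end.

(** * The Min-Plus product *)

Definition entries_le (M m n : nat) (A : 'M[nat]_(m, n)) : Prop :=
  forall i j, A i j <= M.

Definition is_minplus (n1 n2 n3 : nat) (A : 'M[nat]_(n1, n2))
    (B : 'M[nat]_(n2, n3)) (C : 'M[nat]_(n1, n3)) : Prop :=
  forall i j, (exists k, C i j = A i k + B k j) /\
              (forall k, C i j <= A i k + B k j).

(** * Encodings *)

(* Row-major order. *)
Definition enc_mx (m n : nat) (A : 'M[nat]_(m, n)) : seq nat :=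
  [seq A i j | i <- enum 'I_m, j <- enum 'I_n].

Definition enc_minplus (n1 n2 n3 M : nat) (A : 'M[nat]_(n1, n2))
    (B : 'M[nat]_(n2, n3)) : seq nat :=
  [:: n1; n2; n3; M] ++ enc_mx A ++ enc_mx B.

(* The number of vertices, followed by the adjacency matrix. *)
Definition enc_graph (N : nat) (e : rel 'I_N) : seq nat :=
  N :: enc_mx (\matrix_(u < N, v < N) nat_of_bool (e u v)).

Definition enc_dist (d : option nat) : nat := if d is Some m then m.+1 else 0.

(* The number of vertices, followed by the matrix of all distances. *)
Definition enc_apsp (N : nat) (e : rel 'I_N) : seq nat :=
  N :: enc_mx (\matrix_(u < N, v < N) enc_dist (dist e u v)).

(* Main.v *)
Require Import Defs.
From mathcomp Require Import all_boot all_order all_algebra.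
From mathcomp Require Import reals exp.
From mathcomp Require Import zify lra.
(* Otherwise [mem] would be [ssrbool.mem]. *)
Import Defs.
Set Implicit Arguments.
Unset Strict Implicit.
Unset Printing Implicit Defensive.

(* The graph consists of one directed path, cut into [n2] blocks of [2 * M + 1]
   vertices, of a source vertex for each row [i] of [A], and of a sink vertex
   for each column [j] of [B].  Source [i] has an edge to the vertex [A i k]
   places before the middle of block [k], and the vertex [B k j] places after
   the middle of block [k] has an edge to sink [j].  A walk from [i] to [j]
   through block [k] alone has length [A i k + B k j + 2], and a walk that
   passes into another block is longer, so the distance is [C i j + 2].  Since
   [n2] and [M] are within 1 of [n ^ k] and [n ^ (1 - k)], the path has at most
   [10 * n] vertices, and only [O(n^2)] cells of the adjacency matrix
   are nonzero, so the zero-initialised memory lets them be written in [O(n^2)]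
   steps.  The programs take [n2] and [M] from the input, so that they do not
   depend on [k]. *)

(** * Straight-line expressions and counting loops on the word RAM *)

Inductive expr :=
| Var of nat
| Lit of nat
| Bin of binop & expr & expr
| Cell of expr.

Declare Scope expr_scope.
Bind Scope expr_scope with expr.
Delimit Scope expr_scope with E.
Notation "a + b" := (Bin Add a b) : expr_scope.
Notation "a - b" := (Bin Sub a b) : expr_scope.
Notation "a * b" := (Bin Mul a b) : expr_scope.

Fixpoint eval (v : seq nat) (m : nat -> nat) (e : expr) : nat :=
  match e with
  | Var r => nth 0 v r
  | Lit x => x
  | Bin o a b => eval_op o (eval v m a) (eval v m b)
  | Cell a => m (eval v m a)
  end.

(** Every intermediate value has to be a word. For [Cell] only the address is constrained, since
    [Get] carries no bound on the value it loads. *)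
Fixpoint fits (W : nat) (v : seq nat) (m : nat -> nat) (e : expr) : bool :=
  match e with
  | Var r => (r < size v) && (nth 0 v r < W)
  | Lit x => x < W
  | Bin o a b => [&& fits W v m a, fits W v m b &
                     eval_op o (eval v m a) (eval v m b) < W]
  | Cell a => fits W v m a
  end.

(** A variable costs 2 because the machine has no register copy: 0 is loaded and the variable is
    added to it. *)
Fixpoint cost (e : expr) : nat :=
  match e with
  | Var _ => 2
  | Lit _ => 1
  | Bin _ a b => cost a + (cost b + 1)
  | Cell a => cost a + 1
  end.

(* The value ends up in register [d]; only registers from [d] on are changed. *)
Fixpoint compile (d : nat) (e : expr) : prog :=
  match e with
  | Var r => Seq (Const d 0) (Op Add d r d)
  | Lit x => Const d x
  | Bin o a b => Seq (compile d a) (Seq (compile d.+1 b) (Op o d d d.+1))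
  | Cell a => Seq (compile d a) (Get d d)
  end.

(** Registers from [size v] on stay free for scratch values, and memory is compared pointwise. *)
Definition represents (s : state) (v : seq nat) (m : nat -> nat) : Prop :=
  (forall r, r < size v -> reg s r = nth 0 v r) /\ mem s =1 m.

Lemma represents_scratch s s' v m d :
  represents s v m -> size v <= d ->
  (forall r, r < d -> reg s' r = reg s r) -> mem s' = mem s ->
  represents s' v m.
Proof.
move=> [rs ms] dv rE mE; split=> [r rv|a]; last by rewrite mE ms.
by rewrite rE ?rs // (leq_trans rv).
Qed.

(** The second operand is compiled one register higher, so the value of the first survives in
    [d]. *)
Lemma exec_compile W e d s v m :
  represents s v m -> size v <= d -> fits W v m e ->
  exists s', [/\ exec W (compile d e) s (cost e) s',
                 forall r, r < d -> reg s' r = reg s r,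
                 reg s' d = eval v m e & mem s' = mem s].
Proof.
elim: e d s => [r|x|o a IHa b IHb|a IHa] d s sv vd /=.
- move=> /andP[rv rW]; have rd := leq_trans rv vd.
  have E1 : exec W (Const d 0) s 1 (set_reg s d 0).
    by constructor; apply: leq_ltn_trans rW.
  have E2 : exec W (Op Add d r d) (set_reg s d 0) 1
      (set_reg (set_reg s d 0) d
         (reg (set_reg s d 0) r + reg (set_reg s d 0) d)).
    by constructor; rewrite /= eqxx (ltn_eqF rd) addn0 sv.1.
  exists (set_reg (set_reg s d 0) d
            (reg (set_reg s d 0) r + reg (set_reg s d 0) d)).
  split=> //=; first exact: (ExecSeq E1 E2).
    by move=> q qd; rewrite (ltn_eqF qd).
  by rewrite !eqxx (ltn_eqF rd) addn0 sv.1.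
- move=> xW; exists (set_reg s d x); split=> //=; first exact: ExecConst.
    by move=> q qd; rewrite (ltn_eqF qd).
  by rewrite eqxx.
- move=> /and3P[fa fb oW].
  have [s1 [E1 r1 d1 m1]] := IHa _ _ sv vd fa.
  have sv1 := represents_scratch sv vd r1 m1.
  have [s2 [E2 r2 d2 m2]] := IHb _ _ sv1 (leqW vd) fb.
  have E3 : exec W (Op o d d d.+1) s2 1
      (set_reg s2 d (eval_op o (reg s2 d) (reg s2 d.+1))).
    by constructor; rewrite d2 r2 // d1.
  exists (set_reg s2 d (eval_op o (reg s2 d) (reg s2 d.+1))).
  split=> /=; first exact: (ExecSeq E1 (ExecSeq E2 E3)).
  + by move=> q qd; rewrite (ltn_eqF qd) r2 ?r1 // ltnW.
  + by rewrite eqxx d2 r2 // d1.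
  + by rewrite m2.
- move=> fa; have [s1 [E1 r1 d1 m1]] := IHa _ _ sv vd fa.
  exists (set_reg s1 d (mem s1 (reg s1 d))).
  split=> //=; first exact: (ExecSeq E1 (ExecGet _ _ _ _)).
    by move=> q qd; rewrite (ltn_eqF qd) r1.
  by rewrite eqxx d1 m1 sv.2.
Qed.

(** * Time-bounded program triples and logs of memory writes *)

Definition runs (W : nat) (p : prog) (v : seq nat) (m : nat -> nat) (t : nat)
    (v' : seq nat) (m' : nat -> nat) : Prop :=
  forall s, represents s v m ->
  exists t' s', [/\ t' <= t, exec W p s t' s' & represents s' v' m'].

Lemma runs_seq W p q v m t v1 m1 t1 v2 m2 :
  runs W p v m t v1 m1 -> runs W q v1 m1 t1 v2 m2 ->
  runs W (Seq p q) v m (t + t1) v2 m2.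
Proof.
move=> Hp Hq s /Hp[ta [sa [la ea /Hq[tb [sb [lb eb rb]]]]]].
by exists (ta + tb), sb; split=> //; [exact: leq_add|exact: ExecSeq ea eb].
Qed.

(* Program variables live in registers below [nvars], scratch values above. *)
Definition nvars : nat := 8.

(** The value is computed in scratch registers and then copied by adding 0: compiling straight into
    [r] could overwrite variables that [e] still reads. *)
Definition assign (r : nat) (e : expr) : prog :=
  Seq (compile nvars e) (Seq (Const nvars.+1 0) (Op Add r nvars nvars.+1)).

Definition store (a e : expr) : prog :=
  Seq (compile nvars a) (Seq (compile nvars.+1 e) (Put nvars nvars.+1)).

Lemma runs_assign W r e v m :
  r < size v -> size v <= nvars -> fits W v m e -> eval v m e < W ->
  runs W (assign r e) v m (cost e + 2) (set_nth 0 v r (eval v m e)) m.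
Proof.
move=> rv vn fe eW s sv; have [s1 [E1 r1 d1 m1]] := exec_compile sv vn fe.
set s2 := set_reg s1 nvars.+1 0.
have E2 : exec W (Const nvars.+1 0) s1 1 s2.
  by constructor; apply: leq_ltn_trans eW.
set s3 := set_reg s2 r (reg s2 nvars + reg s2 nvars.+1).
have d2 : reg s2 nvars + reg s2 nvars.+1 = eval v m e.
  by rewrite /= d1 addn0.
have E3 : exec W (Op Add r nvars nvars.+1) s2 1 s3.
  by constructor; rewrite [eval_op _ _ _]d2.
exists (cost e + 2), s3; split=> //.
  exact: (ExecSeq E1 (ExecSeq E2 E3)).
split=> [q|a]; last by rewrite /= m1 sv.2.
rewrite size_set_nth (maxn_idPr rv) => qv; rewrite /s3 d2 nth_set_nth /=.
case: ifP => // _; have qn := leq_trans qv vn.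
by rewrite (ltn_eqF (ltnW qn : q < nvars.+1)) r1 // sv.1.
Qed.

Definition writes (m : nat -> nat) (ws : seq (nat * nat)) : nat -> nat :=
  foldl (fun m w => [eta m with w.1 |-> w.2]) m ws.

Lemma writes_cat m ws ws' : writes m (ws ++ ws') = writes (writes m ws) ws'.
Proof. exact: foldl_cat. Qed.

(** All writes to [a] carry the same value, so neither their order nor their number matters. *)
Lemma writesE m ws a x :
  {in ws, forall w, w.1 = a -> w.2 = x} ->
  writes m ws a = if a \in unzip1 ws then x else m a.
Proof.
elim/last_ind: ws => [//|ws w IH] H; rewrite /writes foldl_rcons /=.
rewrite /unzip1 map_rcons mem_rcons inE; case: eqP => [aw|_] /=.
  by apply: H; rewrite ?mem_rcons ?mem_head.
by apply: IH => u uw; apply: H; rewrite mem_rcons inE uw orbT.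
Qed.

Lemma runs_store W a e v m :
  size v <= nvars -> fits W v m a -> fits W v m e ->
  runs W (store a e) v m (cost a + (cost e + 1)) v
    (writes m [:: (eval v m a, eval v m e)]).
Proof.
move=> vn fa fe s sv; have [s1 [E1 r1 d1 m1]] := exec_compile sv vn fa.
have sv1 := represents_scratch sv vn r1 m1.
have [s2 [E2 r2 d2 m2]] := exec_compile sv1 (leqW vn) fe.
exists (cost a + (cost e + 1)), (set_mem s2 (reg s2 nvars) (reg s2 nvars.+1)).
split=> //; first exact: (ExecSeq E1 (ExecSeq E2 (ExecPut _ _ _ _))).
have [rs2 ms2] := represents_scratch sv1 (leqW vn) r2 m2.
split=> [q|x] /=; first exact: rs2.
by rewrite d2 r2 // d1 ms2.
Qed.

Definition agree_below (L : nat) (m m' : nat -> nat) : Prop :=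
  forall a, a < L -> m' a = m a.

Lemma agree_below_writes L m m' ws :
  agree_below L m m' -> all (fun w => L <= w.1) ws ->
  agree_below L m (writes m' ws).
Proof.
move=> mm' /allP Lws a aL; rewrite (@writesE _ _ _ 0).
  case: ifP => [/mapP[w /Lws]|_]; last exact: mm'.
  by move=> Lw aw; rewrite aw ltnNge Lw in aL.
by move=> w /Lws Lw wa; rewrite -wa ltnNge Lw in aL.
Qed.

(* [p] may read the cells below [L], where memory agrees with [m], and writes
   [ws] above them; the variables are unchanged in the end. *)
Definition emits (W L : nat) (m : nat -> nat) (p : prog) (v : seq nat)
    (t : nat) (ws : seq (nat * nat)) : Prop :=
  all (fun w => L <= w.1) ws /\
  forall m', agree_below L m m' -> runs W p v m' t v (writes m' ws).

Lemma emits_store W L m a e v x y :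
  size v <= nvars -> L <= x ->
  (forall m', agree_below L m m' ->
     [/\ fits W v m' a, fits W v m' e, eval v m' a = x & eval v m' e = y]) ->
  emits W L m (store a e) v (cost a + (cost e + 1)) [:: (x, y)].
Proof.
move=> vn Lx H; split=> [|m' /H[fa fe <- <-]]; first by rewrite /= Lx.
exact: runs_store.
Qed.

Lemma emits_seq W L m p q v t ws t' ws' :
  emits W L m p v t ws -> emits W L m q v t' ws' ->
  emits W L m (Seq p q) v (t + t') (ws ++ ws').
Proof.
move=> [Lp Hp] [Lq Hq]; split=> [|m' mm']; first by rewrite all_cat Lp.
rewrite writes_cat; apply: runs_seq (Hp _ mm') (Hq _ _).
exact: agree_below_writes.
Qed.

Lemma runs_while W i b p (v_ : nat -> seq nat) (m_ : nat -> nat -> nat) x t :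
  (forall y, [/\ i < size (v_ y), b < size (v_ y), nth 0 (v_ y) i = y &
                 nth 0 (v_ y) b = x]) ->
  (forall y, y < x -> runs W p (v_ y) (m_ y) t (v_ y.+1) (m_ y.+1)) ->
  runs W (WhileLt i b p) (v_ 0) (m_ 0) (x * t.+1 + 1) (v_ x) (m_ x).
Proof.
move=> Hv Hp.
suff: forall z y, y + z = x ->
    runs W (WhileLt i b p) (v_ y) (m_ y) (z * t.+1 + 1) (v_ x) (m_ x).
  by move=> H; apply: H.
elim=> [|z IH] y yz s sv.
  have yx : y = x by rewrite -yz addn0.
  exists 1, s; split=> //; last by rewrite -yx.
  apply: ExecWhileF; have [iv bv iE bE] := Hv y.
  by rewrite !sv.1 // iE bE yx ltnn.
have yx : y < x by rewrite -yz -addSnnS leq_addr.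
have [t1 [s1 [l1 E1 sv1]]] := Hp _ yx _ sv.
have [t2 [s2 [l2 E2 sv2]]] := IH y.+1 ltac:(lia) _ sv1.
exists (t1 + t2).+1, s2; split=> //.
  by rewrite mulSn -addnA addSn ltnS leq_add.
apply: ExecWhileT E1 E2.
by have [iv bv iE bE] := Hv y; rewrite !sv.1 // iE bE.
Qed.

(* The counter is reset after the loop, hence it is assumed to be 0 before. *)
Definition for_below (i b : nat) (p : prog) : prog :=
  Seq (WhileLt i b (Seq p (assign i (Var i + Lit 1)))) (assign i (Lit 0)).

Lemma emits_for W L m i b p v x t (ws : nat -> seq (nat * nat)) :
  size v <= nvars -> i < size v -> b < size v -> i != b ->
  nth 0 v i = 0 -> nth 0 v b = x -> x.+1 < W ->
  (forall y, y < x -> emits W L m p (set_nth 0 v i y) t (ws y)) ->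
  emits W L m (for_below i b p) v (x * (t + 7) + 4)
    (flatten [seq ws y | y <- iota 0 x]).
Proof.
move=> vn iv bv ib i0 bx xW Hp.
have sz y : size (set_nth 0 v i y) = size v by rewrite size_set_nth; lia.
have setv y z : set_nth 0 (set_nth 0 v i y) i z = set_nth 0 v i z.
  by rewrite set_set_nth eqxx.
have v0 : set_nth 0 v i 0 = v.
  apply: (@eq_from_nth _ 0) => [|r _]; rewrite ?sz // nth_set_nth /=.
  by case: eqP => // ->.
have Lws z : z <= x ->
    all (fun w => L <= w.1) (flatten [seq ws y | y <- iota 0 z]).
  move=> zx; apply/allP => w /flatten_mapP[y].
  rewrite mem_iota add0n => yz; have [/allP Lw _] := Hp y (leq_trans yz zx).
  exact: Lw.
split=> [|m' mm']; first exact: Lws.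
pose m_ z := writes m' (flatten [seq ws y | y <- iota 0 z]).
(* Each pass costs 1 for the test, [t] for the body and 6 for the increment; at the end come 1 for
   the failing test and 3 for the reset. *)
have -> : x * (t + 7) + 4 = (x * (t + 6).+1 + 1) + (1 + 2) by lia.
have W1 : runs W (WhileLt i b (Seq p (assign i (Var i + Lit 1))))
    (set_nth 0 v i 0) (m_ 0) (x * (t + 6).+1 + 1) (set_nth 0 v i x) (m_ x).
  apply: (runs_while (v_ := fun y => set_nth 0 v i y) (m_ := m_)) => [y|y yx].
    by rewrite sz !nth_set_nth /= eqxx eq_sym (negbTE ib).
  apply: (@runs_seq _ _ _ _ _ _ (set_nth 0 v i y) (m_ y.+1)).
    have -> : m_ y.+1 = writes (m_ y) (ws y).
      rewrite /m_ -writes_cat -addn1 iotaD map_cat flatten_cat /=.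
      by rewrite add0n cats0.
    apply: (Hp y yx).2; apply: agree_below_writes mm' (Lws _ _).
    exact: ltnW.
  have Ev : eval (set_nth 0 v i y) (m_ y.+1) (Var i + Lit 1) = y.+1.
    by rewrite /= nth_set_nth /= eqxx addn1.
  rewrite -(setv y y.+1) -{2}Ev.
  apply: (@runs_assign _ i (Var i + Lit 1)%E).
  - by rewrite sz.
  - by rewrite sz.
  - by rewrite /= sz nth_set_nth /= eqxx iv /=; lia.
  - by rewrite Ev; lia.
have W2 : runs W (assign i (Lit 0)) (set_nth 0 v i x) (m_ x) (1 + 2)
    (set_nth 0 (set_nth 0 v i x) i 0) (m_ x).
  by apply: (@runs_assign _ i (Lit 0)); rewrite ?sz //=; lia.
rewrite v0 in W1; rewrite setv v0 in W2; exact: runs_seq W1 W2.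
Qed.

Lemma runs_computes W p inp out t v m :
  all (fun x => x < W) inp -> size inp <= W ->
  runs W p (nseq nvars 0) (nth 0 inp) t v m ->
  0 < size v -> nth 0 v 0 + size out <= W ->
  (forall i, i < size out -> m (nth 0 v 0 + i) = nth 0 out i) ->
  computes W p inp out t.
Proof.
move=> iW sW Hp v0 bW mE; have [|t' [s [tt E [rs ms]]]] := Hp (init inp).
  by split=> [r|//]; rewrite nth_nseq if_same.
split=> //; exists t', s; split=> //; rewrite rs // => i /mE <-.
exact: ms.
Qed.

(** * Walks and distances *)

Section Walks.
Context {T : finType}.
Implicit Types (e : rel T) (u v w : T).

Lemma walk0 e u v : walk e u v 0 = (u == v).
Proof.
apply/existsP/eqP => [[p]|->]; first by rewrite (tuple0 p) => /eqP.
by exists [tuple]; rewrite /= eqxx.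
Qed.

Lemma walkS e u v m :
  reflect (exists2 w, e u w & walk e w v m) (walk e u v m.+1).
Proof.
apply: (iffP existsP) => [[p]|[w uw /existsP[p /andP[pe pl]]]].
  case/tupleP: p => w p /= /andP[/andP[uw pe] pl].
  by exists w => //; apply/existsP; exists p; rewrite pe pl.
by exists [tuple of w :: p]; rewrite /= uw pe pl.
Qed.

Lemma walk_rcons e u v w m : walk e u v m -> e v w -> walk e u w m.+1.
Proof.
elim: m u => [|m IH] u.
  by rewrite walk0 => /eqP-> vw; apply/walkS; exists w; rewrite ?walk0.
by case/walkS=> x ux xv vw; apply/walkS; exists x => //; apply: IH.
Qed.

Lemma walk_connect e u v m : walk e u v m -> connect e u v.
Proof.
by case/existsP=> p /andP[pe /eqP <-]; apply/connectP; exists p.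
Qed.

Lemma dist_eq e u v m :
  walk e u v m -> (forall m', walk e u v m' -> m <= m') ->
  dist e u v = Some m.
Proof.
move=> uvm m_min; rewrite /dist; case: {-}_ / idP => [uv|]; last first.
  by move/negP; rewrite (walk_connect uvm).
congr Some; case: ex_minnP => x ux x_min; apply/eqP.
by rewrite eqn_leq x_min // m_min.
Qed.

(** A shortest path visits no vertex twice, so its length is below [#|T|]. This makes the distance
    matrix a legal input made of words. *)
Lemma enc_dist_le e u v : enc_dist (dist e u v) <= #|T|.
Proof.
rewrite /dist; case: {-}_ / idP => [uv|//] /=.
case: ex_minnP => x _ x_min; have /connectP[p pe vl] := uv.
case: (shortenP pe) vl => q qe qu _ vl.
have /x_min xq : walk e u v (size q).
  by apply/existsP; exists (in_tuple q); rewrite qe vl /=.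
by apply: leq_ltn_trans xq _; rewrite -[_.+1]/(size (u :: q)) -(card_uniqP qu)
  max_card.
Qed.

End Walks.

(** * The graph *)

(* The vertices [0 .. P] with [P := path_len n2 M] form a path, on which the
   inner index [k] owns the block of the [2 * M + 1] vertices starting at
   [k * (2 * M + 1)]; row [i] is the vertex [P + 1 + i] and column [j] the
   vertex [P + 1 + n + j]. *)
Definition path_len (n2 M : nat) : nat := n2 * (M + M + 1).

Definition nverts (n n2 M : nat) : nat := path_len n2 M + 1 + (n + n).

Lemma nvertsE n n2 M : nverts n n2 M = path_len n2 M + 1 + (n + n).
Proof. by []. Qed.

Definition entry (M : nat) (a : nat -> nat -> nat) (i k : nat) : nat :=
  k * (M + M + 1) + (M - a i k).

Definition exit (M : nat) (b : nat -> nat -> nat) (k j : nat) : nat :=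
  k * (M + M + 1) + (M + b k j).

(** The list follows the order in which the program writes the edges, so that its log of writes is
    the image of this list. *)
Definition edges (n n2 M : nat) (a b : nat -> nat -> nat) : seq (nat * nat) :=
  [seq (q, q.+1) | q <- iota 0 (path_len n2 M)] ++
  [seq (path_len n2 M + 1 + i, entry M a i k) |
     i <- iota 0 n, k <- iota 0 n2] ++
  [seq (exit M b k j, path_len n2 M + 1 + n + j) |
     k <- iota 0 n2, j <- iota 0 n].

Definition edge_rel (n n2 M : nat) (a b : nat -> nat -> nat) :
    rel 'I_(nverts n n2 M) :=
  fun u v => (u : nat, v : nat) \in edges n n2 M a b.

Variant edge_spec (n n2 M : nat) (a b : nat -> nat -> nat) (u v : nat) : Prop :=
| EdgePath of u < path_len n2 M & v = u.+1
| EdgeIn i k of i < n & k < n2 & u = path_len n2 M + 1 + i & v = entry M a i k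
| EdgeOut k j of k < n2 & j < n &
    u = exit M b k j & v = path_len n2 M + 1 + n + j.

Lemma mem_iota0 n i : (i \in iota 0 n) = (i < n).
Proof. by rewrite mem_iota add0n. Qed.

Lemma edgesP n n2 M a b u v :
  reflect (edge_spec n n2 M a b u v) ((u, v) \in edges n n2 M a b).
Proof.
rewrite !mem_cat; apply: (iffP or3P).
- case=> [/mapP[q]|/allpairsP[[i k] []]|/allpairsP[[k j] []]] /=.
  + by rewrite mem_iota0 => qP [-> ->]; apply: EdgePath.
  + rewrite !mem_iota0 => lt_i lt_k [-> ->]; exact: (EdgeIn _ lt_i lt_k).
  + rewrite !mem_iota0 => lt_k lt_j [-> ->]; exact: (EdgeOut _ lt_k lt_j).
- case=> [uP ->|i k lt_i lt_k -> ->|k j lt_k lt_j -> ->].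
  + by constructor 1; apply/mapP; exists u; rewrite ?mem_iota0.
  + by constructor 2; apply/allpairsP; exists (i, k); rewrite !mem_iota0.
  + by constructor 3; apply/allpairsP; exists (k, j); rewrite !mem_iota0.
Qed.

Definition bounded (M m n : nat) (f : nat -> nat -> nat) : Prop :=
  forall i j, i < m -> j < n -> f i j <= M.

Lemma block_le n2 M k :
  k < n2 -> k * (M + M + 1) + (M + M + 1) <= path_len n2 M.
Proof. by move=> kn; rewrite addnC -mulSn leq_mul2r kn orbT. Qed.

Lemma entry_lt n2 M a i k : k < n2 -> entry M a i k < path_len n2 M.
Proof. by move=> /(block_le M); rewrite /entry; lia. Qed.

Lemma exit_lt n n2 M b k j :
  bounded M n2 n b -> k < n2 -> j < n -> exit M b k j < path_len n2 M.
Proof.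
move=> bM kn jn; have := block_le M kn; have := bM _ _ kn jn.
by rewrite /exit; lia.
Qed.

Lemma edges_lt n n2 M a b u v :
  bounded M n2 n b -> (u, v) \in edges n n2 M a b ->
  (u < nverts n n2 M) /\ (v < nverts n n2 M).
Proof.
rewrite nvertsE => bM /edgesP[uP ->|i k iN kN -> ->|k j kN jN -> ->].
- by lia.
- by have := entry_lt M a i kN; lia.
- by have := exit_lt bM kN jN; lia.
Qed.

Lemma walk_path n n2 M a b d (u v : 'I_(nverts n n2 M)) :
  v = u + d :> nat -> v <= path_len n2 M -> walk (edge_rel a b) u v d.
Proof.
elim: d u => [|d IH] u uv vP.
  by rewrite walk0; apply/eqP/val_inj; rewrite /= uv addn0.
have uP : u < path_len n2 M by move: vP; rewrite uv; lia.
have wN : u.+1 < nverts n n2 M by have := nvertsE n n2 M; lia.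
apply/walkS; exists (Ordinal wN); last by apply: IH; rewrite //= uv addSnnS.
by apply/edgesP; apply: EdgePath.
Qed.

(** From a path vertex one can only advance by one or leave to a column, and columns have no
    outgoing edges. So the walk climbs to an exit of column [j] and leaves there by its last
    edge. *)
Lemma walk_to_column n n2 M a b m (u v : 'I_(nverts n n2 M)) j :
  bounded M n2 n b ->
  u <= path_len n2 M -> v = path_len n2 M + 1 + n + j :> nat ->
  walk (edge_rel a b) u v m ->
  exists k, [/\ k < n2, u <= exit M b k j & u + m = exit M b k j + 1].
Proof.
move=> bM + vj; elim: m u => [|m IH] u uP.
  by rewrite walk0 => /eqP uv; move: uP; rewrite uv vj; lia.
case/walkS=> w /edgesP[uP' wu|i k iN kN ui _|k j' kN jN uk wj] wv.
- have [|k [kN wk uE]] := IH w _ wv; first by rewrite wu.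
  by exists k; split=> //; [apply: ltnW; rewrite -wu|rewrite -addSnnS -wu].
- by rewrite ui in uP; lia.
- exists k; case: m wv {IH} => [|m].
    rewrite walk0 uk => /eqP wv; move: wj; rewrite wv vj => jj'.
    by have -> : j = j' by lia.
  (* A further edge would have to start at the column vertex [w]. *)
  case/walkS=> x /edgesP[|i' k' iN' _|k' j'' kN' jN'] + _; rewrite wj.
  + by lia.
  + by lia.
  + by have := exit_lt bM kN' jN'; lia.
Qed.

(* A walk that leaves the block in which it entered the path has length more
   than [2 * M + 2], which is at least the length through that block. *)
Lemma dist_edge_rel n n2 M a b (u v : 'I_(nverts n n2 M)) i j c :
  bounded M n n2 a -> bounded M n2 n b -> i < n -> j < n ->
  u = path_len n2 M + 1 + i :> nat -> v = path_len n2 M + 1 + n + j :> nat ->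
  (exists2 k, k < n2 & c = a i k + b k j) ->
  (forall k, k < n2 -> c <= a i k + b k j) ->
  dist (edge_rel a b) u v = Some (c + 2).
Proof.
move=> aM bM iN jN ui vj [k kN ck] c_min.
have Na k' : k' < n2 -> entry M a i k' < nverts n n2 M.
  by move=> /(entry_lt M a i); rewrite nvertsE; lia.
apply: dist_eq => [|m].
  have xN : exit M b k j < nverts n n2 M.
    by have := exit_lt bM kN jN; rewrite nvertsE; lia.
  (* One edge in, [c] steps along the path, one edge out. *)
  have -> : c + 2 = c.+1.+1 by lia.
  apply/walkS; exists (Ordinal (Na k kN)).
    by apply/edgesP; apply: (EdgeIn _ iN kN).
  apply: (@walk_rcons _ _ _ (Ordinal xN)).
    apply: walk_path; last by apply/ltnW/(exit_lt bM).
    by rewrite /= /entry /exit ck; have := aM _ _ iN kN; lia.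
  by apply/edgesP; apply: (EdgeOut _ kN jN).
case: m => [|m].
  by rewrite walk0 => /eqP uv; move: vj; rewrite -uv ui; lia.
case/walkS=> w /edgesP[|i' k1 iN' k1N ui' wE|k1 j' k1N jN' uE _]; first by lia.
  have Ei : i' = i by lia.
  rewrite {}Ei {i' iN' ui'} in wE *; move=> wv.
  have wP : w <= path_len n2 M by rewrite wE; apply/ltnW/entry_lt.
  have [k2 [k2N]] := walk_to_column bM wP vj wv.
  have := aM _ _ iN k1N; have := bM _ _ k1N jN; have := bM _ _ k2N jN.
  have := c_min _ k1N; rewrite {}wE /entry /exit.
  (* If [k1 < k2], entry and exit are at least [2 * M + 1] apart, which exceeds [c]. If [k2 < k1],
     the exit would lie before the entry on a path that only goes forward. *)
  case: (ltngtP k1 k2) => [lt12|lt21|<-]; last by lia.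
    by have := leq_mul lt12 (leqnn (M + M + 1)); lia.
  by have := leq_mul lt21 (leqnn (M + M + 1)); lia.
by have := exit_lt bM k1N jN'; lia.
Qed.

(** * Row-major encodings *)

Lemma nth_allpairs (S T R : Type) (f : S -> T -> R) x0 s0 t0 s t i j :
  i < size s -> j < size t ->
  nth x0 [seq f x y | x <- s, y <- t] (i * size t + j) =
  f (nth s0 s i) (nth t0 t j).
Proof.
elim: s i => [//|x s IH] [|i] /= si tj; rewrite nth_cat size_map.
  by rewrite mul0n add0n tj (nth_map t0).
rewrite mulSn -addnA ltnNge leq_addr /= addKn; exact: IH.
Qed.

Lemma nth_enc_mx (m n : nat) (A : 'M[nat]_(m, n)) (i : 'I_m) (j : 'I_n) :
  nth 0 (enc_mx A) (i * n + j) = A i j.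
Proof.
have := @nth_allpairs _ _ _ A 0 i j (enum 'I_m) (enum 'I_n) i j.
by rewrite !size_enum_ord !nth_ord_enum; apply.
Qed.

Lemma size_enc_mx (m n : nat) (A : 'M[nat]_(m, n)) : size (enc_mx A) = m * n.
Proof. by rewrite size_allpairs !size_enum_ord. Qed.

Lemma all_enc_mx (p : pred nat) (m n : nat) (A : 'M[nat]_(m, n)) :
  (forall i j, p (A i j)) -> all p (enc_mx A).
Proof. by move=> pA; apply/allP => _ /allpairsP[[i j] [_ _ ->]] /=. Qed.

Lemma row_major_inj n u v u' v' :
  v < n -> v' < n -> u * n + v = u' * n + v' -> u = u' /\ v = v'.
Proof.
move=> vn vn' E; have n0 : 0 < n by exact: leq_ltn_trans vn.
split.
  by move: (congr1 (divn^~ n) E); rewrite !divnMDl // !divn_small // !addn0.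
by rewrite -(modn_small vn) -(modn_small vn') -(modnMDl u) E modnMDl.
Qed.

Lemma row_major_lt m n i j : i < m -> j < n -> i * n + j < m * n.
Proof. by move=> im jn; have := leq_mul im (leqnn n); lia. Qed.

(** * The programs *)

(* Registers: 0 output address, 1 [n], 2 [n2], 3 [M], 4 number of vertices,
   5 [path_len n2 M], 6 and 7 loop counters. *)

Definition block : expr := (Var 3 + Var 3 + Lit 1)%E.

(** The [Lit 1] in the address skips the cell that holds the number of vertices. *)
Definition put_edge (u v : expr) : prog :=
  store (Var 0 + Lit 1 + (u * Var 4 + v)) (Lit 1).

Definition build_path : prog :=
  for_below 6 5 (put_edge (Var 6) (Var 6 + Lit 1)).

(** Four header cells precede the matrices: [A] starts at address 4 and [B] at [4 + n * n2]. *)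
Definition build_in : prog :=
  for_below 6 1 (for_below 7 2 (put_edge (Var 5 + Lit 1 + Var 6)
    (Var 7 * block + (Var 3 - Cell (Lit 4 + (Var 6 * Var 2 + Var 7)))))).

Definition build_out : prog :=
  for_below 6 2 (for_below 7 1 (put_edge
    (Var 6 * block +
       (Var 3 + Cell (Lit 4 + Var 1 * Var 2 + (Var 6 * Var 1 + Var 7))))
    (Var 5 + Lit 1 + Var 1 + Var 7))).

(** Common to both programs, whose inputs both start with [n; n2; n; M]. *)
Definition load_sizes : prog :=
  Seq (assign 1 (Cell (Lit 0)))
 (Seq (assign 2 (Cell (Lit 1)))
 (Seq (assign 3 (Cell (Lit 3)))
      (assign 5 (Var 2 * block)))).

(** The output block starts right after the input, of length [4 + 2 * (n * n2)], where all cells are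
    still 0. *)
Definition build_graph : prog :=
  Seq load_sizes
 (Seq (assign 4 (Var 5 + Lit 1 + (Var 1 + Var 1)))
 (Seq (assign 0 (Lit 4 + (Var 1 * Var 2 + Var 1 * Var 2)))
 (Seq (store (Var 0) (Var 4))
 (Seq build_path
 (Seq build_in build_out))))).

(** The distances start at address 5, after the header and the number of vertices. The subtracted 3
    is 2 for the edges in and out plus 1 from [enc_dist]. *)
Definition read_product : prog :=
  Seq load_sizes
 (Seq (assign 4 (Cell (Lit 4)))
 (Seq (assign 0 (Lit 5 + Var 4 * Var 4))
      (for_below 6 1 (for_below 7 1
         (store (Var 0 + (Var 6 * Var 1 + Var 7))
            (Cell (Lit 5 + ((Var 5 + Lit 1 + Var 6) * Var 4 +
                            (Var 5 + Lit 1 + Var 1 + Var 7))) - Lit 3)))))).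

Lemma runs_leq W p v m t v' m' t' :
  runs W p v m t v' m' -> t <= t' -> runs W p v m t' v' m'.
Proof.
move=> H tt' s /H[x [y [xt E sv]]]; exists x, y.
by split=> //; apply: leq_trans tt'.
Qed.

Lemma runs_load_sizes W m n n2 M :
  m 0 = n -> m 1 = n2 -> m 3 = M ->
  n < W -> n2 < W -> M < W -> 3 < W -> M + M + 1 < W -> path_len n2 M < W ->
  runs W load_sizes (nseq nvars 0) m 40
    [:: 0; n; n2; M; 0; path_len n2 M; 0; 0] m.
Proof.
move=> m0 m1 m3 nW n2W MW W3 BW PW.
apply: (@runs_leq _ _ _ _ (_ + (_ + (_ + _)))).
  apply: runs_seq; first by apply: runs_assign; rewrite //= ?m0 //; lia.
  apply: runs_seq; first by apply: runs_assign; rewrite //= ?m1 //; lia.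
  apply: runs_seq; first by apply: runs_assign; rewrite //= ?m3 //; lia.
  rewrite /= m0 m1 m3.
  set v := [:: 0; n; n2; M; 0; 0; 0; 0].
  apply: (@runs_assign _ 5 (Var 2 * block)%E v); rewrite //=.
  by rewrite -/(path_len n2 M); lia.
by [].
Qed.

Lemma emits_put_edge W L m eu ew v N u w :
  size v = nvars -> nth 0 v 4 = N -> L <= nth 0 v 0 ->
  u < N -> w < N -> nth 0 v 0 + 1 + N * N < W ->
  (forall m', agree_below L m m' ->
     [/\ fits W v m' eu, fits W v m' ew,
         eval v m' eu = u & eval v m' ew = w]) ->
  emits W L m (put_edge eu ew) v (cost eu + cost ew + 11)
    [:: (nth 0 v 0 + 1 + (u * N + w), 1)].
Proof.
move=> sv vN Lb uN wN NW H; have uwN := row_major_lt uN wN.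
have -> : cost eu + cost ew + 11 =
    cost (Var 0 + Lit 1 + (eu * Var 4 + ew)) + (cost (Lit 1) + 1).
  by rewrite /=; lia.
apply: emits_store => [||m' /H[feu few Eu Ew]]; [by rewrite sv|by lia|].
by rewrite /= feu few Eu Ew sv vN /nvars /=; split=> //; nia.
Qed.

(** * Effect and running time of the graph construction *)

Definition write_edge (base N : nat) (e : nat * nat) : nat * nat :=
  (base + 1 + (e.1 * N + e.2), 1).

Section Build.
Context (W n n2 M : nat) (m : nat -> nat) (a b : nat -> nat -> nat).
Let P := path_len n2 M.
Let N := nverts n n2 M.
Let base := 4 + (n * n2 + n * n2).
Let v := [:: base; n; n2; M; N; P; 0; 0].
Hypothesis HW : base + 1 + N * N < W.
Hypothesis n2_gt0 : 0 < n2.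
Hypothesis aE : forall i k, i < n -> k < n2 -> m (4 + (i * n2 + k)) = a i k.
Hypothesis bE :
  forall k j, k < n2 -> j < n -> m (4 + n * n2 + (k * n + j)) = b k j.
Hypothesis aM : bounded M n n2 a.
Hypothesis bM : bounded M n2 n b.

Let NE : N = P + 1 + (n + n). Proof. by []. Qed.

Let N_lt : N < W.
Proof. by have := leq_pmulr N (_ : 0 < N); rewrite NE; lia. Qed.

Let block_lt : M + M + 1 <= P.
Proof. exact: leq_pmull. Qed.

Let n2_le : n2 <= P.
Proof. by apply: leq_pmulr; rewrite addn1. Qed.

Lemma emits_build_path :
  emits W base m build_path v (P * 24 + 4)
    [seq write_edge base N (q, q.+1) | q <- iota 0 P].
Proof.
rewrite -flatten_map1.
apply: (emits_for (t := 17)) => //; first by lia.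
move=> q qP.
apply: (@emits_put_edge _ _ _ (Var 6) (Var 6 + Lit 1)%E
  [:: base; n; n2; M; N; P; q; 0] N);
  rewrite //=; try lia.
by move=> m' _; split; lia.
Qed.

Lemma emits_build_in :
  emits W base m build_in v (n * (n2 * 50 + 11) + 4)
    [seq write_edge base N (P + 1 + i, entry M a i k) |
       i <- iota 0 n, k <- iota 0 n2].
Proof.
(* One [put_edge] costs 43 here; each loop adds 7 per pass and 4 at its end. *)
have -> : n * (n2 * 50 + 11) + 4 = n * (n2 * (43 + 7) + 4 + 7) + 4 by lia.
apply: emits_for => //; first by lia.
move=> i iN /=; rewrite -flatten_map1.
apply: emits_for => //; first by lia.
move=> k kN /=.
have PE := entry_lt M a i kN; have BE := block_le M kN.
have ik := row_major_lt iN kN; have aik := aM iN kN.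
apply: (@emits_put_edge _ _ _ (Var 5 + Lit 1 + Var 6)%E
  (Var 7 * block + (Var 3 - Cell (Lit 4 + (Var 6 * Var 2 + Var 7))))%E
  [:: base; n; n2; M; N; P; i; k] N); rewrite //=; try lia.
(* The cell read belongs to [A], below [base], so earlier edge writes have not changed it. *)
move=> m' mm'; rewrite mm' /base; last by lia.
rewrite aE // -/(entry M a i k); split=> //; lia.
Qed.

Lemma emits_build_out :
  emits W base m build_out v (n2 * (n * 59 + 11) + 4)
    [seq write_edge base N (exit M b k j, P + 1 + n + j) |
       k <- iota 0 n2, j <- iota 0 n].
Proof.
have -> : n2 * (n * 59 + 11) + 4 = n2 * (n * (52 + 7) + 4 + 7) + 4 by lia.
apply: emits_for => //; first by lia.
move=> k kN /=; rewrite -flatten_map1.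
apply: emits_for => //; first by lia.
move=> j jN /=.
have PE := exit_lt bM kN jN; have BE := block_le M kN.
have kj := row_major_lt kN jN; have bkj := bM kN jN.
apply: (@emits_put_edge _ _ _
  (Var 6 * block +
     (Var 3 + Cell (Lit 4 + Var 1 * Var 2 + (Var 6 * Var 1 + Var 7))))%E
  (Var 5 + Lit 1 + Var 1 + Var 7)%E
  [:: base; n; n2; M; N; P; k; j] N); rewrite //=; try lia.
move=> m' mm'; rewrite mm' /base; last by lia.
rewrite bE // -/(exit M b k j); split=> //; lia.
Qed.

Hypothesis m0 : m 0 = n.
Hypothesis m1 : m 1 = n2.
Hypothesis m3 : m 3 = M.

(** The coefficient 109 is 50 + 59, the costs per entry of [A] and of [B]; 200 covers the constant
    terms. *)
Definition build_time : nat := 200 + 24 * P + 109 * (n * n2) + 11 * n + 11 * n2.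

Lemma runs_build_graph :
  runs W build_graph (nseq nvars 0) m build_time v
    (writes m ((base, N) :: [seq write_edge base N e | e <- edges n n2 M a b])).
Proof.
have -> : (base, N) :: [seq write_edge base N e | e <- edges n n2 M a b] =
    [:: (base, N)] ++
    [seq write_edge base N (q, q.+1) | q <- iota 0 P] ++
    [seq write_edge base N (P + 1 + i, entry M a i k) |
       i <- iota 0 n, k <- iota 0 n2] ++
    [seq write_edge base N (exit M b k j, P + 1 + n + j) |
       k <- iota 0 n2, j <- iota 0 n].
  by rewrite /edges !map_cat !map_allpairs -map_comp.
apply: (@runs_leq _ _ _ _ (40 + (_ + (_ + _)))).
  apply: runs_seq.
    by apply: (runs_load_sizes (n := n) (n2 := n2) (M := M)) => //; lia.
  apply: runs_seq; first by apply: runs_assign; rewrite //=; lia.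
  apply: runs_seq; first by apply: runs_assign; rewrite //=; lia.
  rewrite /= -nvertsE -/N -/P -/base -/v.
  have Hs : emits W base m (store (Var 0) (Var 4)) v 5 [:: (base, N)].
    apply: (@emits_store _ _ _ (Var 0) (Var 4)) => // m' _ /=.
    by split=> //; lia.
  have [_ H] := emits_seq Hs (emits_seq emits_build_path
    (emits_seq emits_build_in emits_build_out)).
  exact: H.
by rewrite /build_time /=; lia.
Qed.

End Build.

(** * Effect and running time of reading off the product *)

Section Read.
Context (W n n2 M : nat) (m : nat -> nat) (c : nat -> nat -> nat).
Let P := path_len n2 M.
Let N := nverts n n2 M.
Let base := 5 + N * N.
Let v := [:: base; n; n2; M; N; P; 0; 0].
Hypothesis HW : base + N * N < W.
Hypothesis n2_gt0 : 0 < n2.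
Hypothesis m0 : m 0 = n.
Hypothesis m1 : m 1 = n2.
Hypothesis m3 : m 3 = M.
Hypothesis m4 : m 4 = N.
Hypothesis mE : forall i j, i < n -> j < n ->
  m (5 + ((P + 1 + i) * N + (P + 1 + n + j))) = c i j + 3.
Hypothesis cW : forall i j, i < n -> j < n -> c i j < W.

Definition read_time : nat := 200 + 100 * (n * n) + 11 * n.

Lemma runs_read_product :
  runs W read_product (nseq nvars 0) m read_time v
    (writes m [seq (base + (i * n + j), c i j) |
                 i <- iota 0 n, j <- iota 0 n]).
Proof.
have NE : N = P + 1 + (n + n) by [].
have NN : N <= N * N by apply: leq_pmulr; rewrite NE; lia.
have N_lt : N < W by lia.
have block_lt : M + M + 1 <= P by exact: leq_pmull.
have n2_le : n2 <= P by apply: leq_pmulr; rewrite addn1.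
have He : emits W base m (for_below 6 1 (for_below 7 1
    (store (Var 0 + (Var 6 * Var 1 + Var 7))
       (Cell (Lit 5 + ((Var 5 + Lit 1 + Var 6) * Var 4 +
                       (Var 5 + Lit 1 + Var 1 + Var 7))) - Lit 3))))
    v (n * (n * (38 + 7) + 4 + 7) + 4)
    [seq (base + (i * n + j), c i j) | i <- iota 0 n, j <- iota 0 n].
  apply: emits_for => //; first by lia.
  move=> i iN /=; rewrite -flatten_map1.
  apply: emits_for => //; first by lia.
  move=> j jN /=.
  have ij := row_major_lt iN jN.
  have nN : n * n <= N * N by apply: leq_mul; lia.
  have uN : P + 1 + i < N by lia.
  have wN : P + 1 + n + j < N by lia.
  have uw := row_major_lt uN wN; have cij := cW iN jN.
  apply: emits_store => //; first by exact: leq_addr.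
  move=> m' mm'; rewrite /= mm' /base; last by lia.
  by rewrite mE // addnK; split=> //; lia.
apply: (@runs_leq _ _ _ _ (40 + (_ + (_ + _)))).
  apply: runs_seq.
    by apply: (runs_load_sizes (n := n) (n2 := n2) (M := M)) => //; lia.
  apply: runs_seq; first by apply: runs_assign; rewrite //= ?m4; lia.
  apply: runs_seq; first by apply: runs_assign; rewrite //= ?m4; lia.
  rewrite /= m4 -/base -/v; exact: He.2.
by rewrite /read_time /=; lia.
Qed.

End Read.

(** * Size estimates and full input-output correctness *)

Lemma row_major_ind m n (Q : nat -> Prop) :
  (forall (i : 'I_m) (j : 'I_n), Q (i * n + j)) -> forall x, x < m * n -> Q x.
Proof.
move=> H x xmn; have n0 : 0 < n by case: (n) xmn => //; rewrite muln0.
have im : x %/ n < m by rewrite ltn_divLR.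
rewrite (divn_eq x n); exact: (H (Ordinal im) (Ordinal (ltn_pmod x n0))).
Qed.

Lemma bounded_enc_mx M m n (A : 'M[nat]_(m, n)) :
  entries_le M A -> bounded M m n (fun i j => nth 0 (enc_mx A) (i * n + j)).
Proof.
by move=> AM i j im jn; rewrite (nth_enc_mx A (Ordinal im) (Ordinal jn)).
Qed.

(** The bound is [X ^ c] with [X] a power of two above [n]: [a] factors [X] pay for [2 ^ a] and two
    more for [n ^ 2]. *)
Lemma word_bound_gt a c n : a + 2 <= c -> 2 ^ a * n ^ 2 < word_bound c n.
Proof.
move=> ac; rewrite /word_bound [c * _]mulnC expnM.
set X := 2 ^ (trunc_log 2 n).+1; have nX : n < X by apply: trunc_log_ltn.
have X2 : 2 <= X by rewrite /X expnS leq_pmulr // expn_gt0.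
apply: (@leq_trans (X ^ (a + 2))); last by rewrite leq_pexp2l // ltnW.
rewrite expnD; apply: (@leq_ltn_trans (X ^ a * n ^ 2)).
  by apply: leq_mul => //; case: (a) => // d; rewrite leq_exp2r.
by rewrite ltn_pmul2l ?expn_gt0 ?ltn_exp2r // (leq_trans _ X2).
Qed.

Section Sizes.
Context (n n2 M : nat).
Hypothesis n_gt0 : 0 < n.
Hypothesis n2_gt0 : 0 < n2.
Hypothesis P_le : path_len n2 M <= 10 * n.

Lemma nverts_le : nverts n n2 M <= 13 * n.
Proof. by rewrite nvertsE; lia. Qed.

Lemma sqr_nverts_le : nverts n n2 M * nverts n n2 M <= 169 * n ^ 2.
Proof. by rewrite -mulnn; have := leq_mul nverts_le nverts_le; lia. Qed.

Lemma inner_le : n2 <= 10 * n.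
Proof. by apply: leq_trans P_le; apply: leq_pmulr; rewrite addn1. Qed.

Lemma entry_bound_lt : M + M < 10 * n.
Proof. by apply: leq_trans P_le; rewrite -addn1; apply: leq_pmull. Qed.

Lemma sqrn_gt0 : 0 < n ^ 2.
Proof. by rewrite expn_gt0 n_gt0. Qed.

Lemma leq_sqrn : n <= n ^ 2.
Proof. by rewrite -mulnn leq_pmulr. Qed.

Lemma area_le : n * n2 <= 10 * n ^ 2.
Proof. by rewrite -mulnn; have := leq_mul (leqnn n) inner_le; lia. Qed.

Lemma build_computes W (A : 'M[nat]_(n, n2)) (B : 'M[nat]_(n2, n)) :
  2 ^ 9 * n ^ 2 < W -> entries_le M A -> entries_le M B ->
  computes W build_graph (enc_minplus M A B)
    (enc_graph (@edge_rel n n2 M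
       (fun i k => nth 0 (enc_mx A) (i * n2 + k))
       (fun k j => nth 0 (enc_mx B) (k * n + j)))) (2000 * n ^ 2).
Proof.
set a := fun i k => _; set b := fun k j => _ => HW AM BM.
have {}HW : 512 * n ^ 2 < W by [].
have aM : bounded M n n2 a := bounded_enc_mx AM.
have bM : bounded M n2 n b := bounded_enc_mx BM.
have n1 := sqrn_gt0; have nn := leq_sqrn.
have nA := area_le; have n2n := inner_le.
have nM := entry_bound_lt; have NN := sqr_nverts_le.
set N := nverts n n2 M in NN *; set inp := enc_minplus _ _ _.
set base := 4 + (n * n2 + n * n2).
have sz_inp : size inp = base.
  by rewrite /inp /enc_minplus !size_cat !size_enc_mx /base (mulnC n2).
have N_gt0 : 0 < N by rewrite /N nvertsE; lia.
have baseW : base + 1 + N * N < W by rewrite /base; lia.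
have R : runs W build_graph (nseq nvars 0) (nth 0 inp) (build_time n n2 M)
    [:: base; n; n2; M; N; path_len n2 M; 0; 0]
    (writes (nth 0 inp)
       ((base, N) :: [seq write_edge base N e | e <- edges n n2 M a b])).
  apply: runs_build_graph => //.
    move=> i k iN kN; rewrite /inp /enc_minplus /= nth_cat size_enc_mx.
    by rewrite row_major_lt.
  move=> k j kN jN; rewrite /inp /enc_minplus -addnA /= nth_cat size_enc_mx.
  by rewrite add0n ltnNge leq_addr /= addKn.
set mf := writes _ _ in R.
have mf_base : mf base = N.
  rewrite /mf (@writesE _ _ _ N) ?mem_head // => w.
  by rewrite inE => /orP[/eqP->//|/mapP[e _ ->]] /=; lia.
have mf_edge (u v : 'I_N) : mf (base + (u * N + v).+1) = edge_rel a b u v.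
  rewrite /mf (@writesE _ _ _ 1); last first.
    by move=> w; rewrite inE => /orP[/eqP->|/mapP[e _ ->//]] /=; lia.
  have -> : (base + (u * N + v).+1 \in
      unzip1 ((base, N) :: [seq write_edge base N e | e <- edges n n2 M a b])) =
      edge_rel a b u v; last first.
    (* A cell that is never written lies beyond the input, where [nth] gives the default 0. *)
    by case: edge_rel => //; rewrite nth_default // sz_inp leq_addr.
  rewrite /unzip1 map_cons in_cons -map_comp gtn_eqF ?addnS ?ltnS ?leq_addr //.
  rewrite orFb -addSn -addn1.
  (* The address determines the edge, because every target is below [N]. *)
  apply/mapP/idP => [[[u' v'] uv' /=]|uv]; last by exists (u : nat, v : nat).
  move=> /addnI E; have [_ vN'] := edges_lt bM uv'.
  by have [] := row_major_inj (ltn_ord v) vN' E; rewrite /edge_rel => -> ->.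
clearbody mf; apply: (runs_computes _ _ (runs_leq R _)) => //.
- rewrite /inp /enc_minplus !all_cat /= !andbT; apply/and3P; split.
  + by apply/and4P; split; lia.
  + by apply: all_enc_mx => i j; have := AM i j; lia.
  + by apply: all_enc_mx => i j; have := BM i j; lia.
- by rewrite sz_inp; lia.
(* With the estimates above, the time is at most [1651 * n ^ 2]. *)
- by rewrite /build_time; lia.
- by rewrite /= size_enc_mx; lia.
move=> x; rewrite /= size_enc_mx; case: x => [_|x]; first by rewrite addn0.
rewrite ltnS; move: x; apply: row_major_ind => u v.
by rewrite mf_edge [RHS]/= nth_enc_mx mxE.
Qed.

Lemma read_computes W (A : 'M[nat]_(n, n2)) (B : 'M[nat]_(n2, n))
    (C : 'M[nat]_(n, n)) :
  2 ^ 9 * n ^ 2 < W -> entries_le M A -> entries_le M B -> is_minplus A B C ->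
  computes W read_product
    ([:: n; n2; n; M] ++ enc_apsp (@edge_rel n n2 M
       (fun i k => nth 0 (enc_mx A) (i * n2 + k))
       (fun k j => nth 0 (enc_mx B) (k * n + j))))
    (enc_mx C) (2000 * n ^ 2).
Proof.
set a := fun i k => _; set b := fun k j => _ => HW AM BM Cmin.
have {}HW : 512 * n ^ 2 < W by [].
have aM : bounded M n n2 a := bounded_enc_mx AM.
have bM : bounded M n2 n b := bounded_enc_mx BM.
have n1 := sqrn_gt0; have nn := leq_sqrn; have n2n := inner_le.
have nM := entry_bound_lt; have NN := sqr_nverts_le; have NW := nverts_le.
set N := nverts n n2 M in NN NW *; set inp := _ ++ _.
set base := 5 + N * N.
have sz_inp : size inp = base by rewrite /inp /= size_enc_mx.
(* The left side is at most [5 + 338 * n ^ 2], hence the power [2 ^ 9] in the assumption on [W]. *)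
have baseW : base + N * N < W by rewrite /base; lia.
pose c i j := nth 0 (enc_mx C) (i * n + j).
have CM i j : C i j <= M + M.
  have [[k ->] _] := Cmin i j; exact: leq_add (AM _ _) (BM _ _).
have R : runs W read_product (nseq nvars 0) (nth 0 inp) (read_time n)
    [:: base; n; n2; M; N; path_len n2 M; 0; 0]
    (writes (nth 0 inp) [seq (base + (i * n + j), c i j) |
                           i <- iota 0 n, j <- iota 0 n]).
  apply: runs_read_product => // i j iN jN; last first.
    rewrite /c (nth_enc_mx C (Ordinal iN) (Ordinal jN)).
    by have := CM (Ordinal iN) (Ordinal jN); lia.
  have uN : path_len n2 M + 1 + i < N by rewrite /N nvertsE; lia.
  have vN : path_len n2 M + 1 + n + j < N by rewrite /N nvertsE; lia.
  rewrite /inp /= (nth_enc_mx _ (Ordinal uN) (Ordinal vN)) mxE.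
  rewrite (dist_edge_rel aM bM iN jN (c := c i j)) //= ?addn2 ?addn3 //.
    have [[k Ck] _] := Cmin (Ordinal iN) (Ordinal jN).
    exists k => //; rewrite /c (nth_enc_mx C (Ordinal iN) (Ordinal jN)) Ck.
    by rewrite -!nth_enc_mx.
  move=> k kN; have [_ /(_ (Ordinal kN))] := Cmin (Ordinal iN) (Ordinal jN).
  by rewrite -!nth_enc_mx.
apply: (runs_computes _ _ (runs_leq R _)) => //.
- rewrite /inp all_cat /=; apply/andP; split; first by apply/and5P; split; lia.
  apply/andP; split; first by lia.
  apply: all_enc_mx => u v; rewrite mxE.
  by apply: leq_ltn_trans (enc_dist_le _ _ _) _; rewrite card_ord; lia.
- by rewrite sz_inp; lia.
- by rewrite /read_time -mulnn; lia.
- by rewrite /= size_enc_mx mulnn; lia.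
rewrite size_enc_mx; apply: row_major_ind => i j.
rewrite (@writesE _ _ _ (C i j)).
  rewrite nth_enc_mx ifT //; apply/mapP.
  exists (base + (i * n + j), c i j) => //.
  by apply/allpairsP; exists (i : nat, j : nat); rewrite !mem_iota0 !ltn_ord.
move=> _ /allpairsP[[i' j'] [/= _ + ->]] /= /addnI E; rewrite mem_iota0 => jN.
by have [-> ->] := row_major_inj jN (ltn_ord j) E; rewrite /c nth_enc_mx.
Qed.

End Sizes.

(** * Existence of the product, real powers and the reduction *)

Lemma minplus_exists n1 n2 n3 (A : 'M[nat]_(n1, n2)) (B : 'M[nat]_(n2, n3)) :
  0 < n2 -> exists C : 'M[nat]_(n1, n3), is_minplus A B C.
Proof.
move=> n2_gt0; pose f i j k := A i k + B k j.
exists (\matrix_(i, j) f i j [arg min_(k < Ordinal n2_gt0) f i j k])%R => i j.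
rewrite mxE; case: arg_minnP => // k _ k_min.
by split=> [|k']; [exists k|exact: k_min].
Qed.

Import Order.TTheory GRing.Theory Num.Theory.

(** Both powers are at least 1 and their product is [n], so rounding by less than 1 costs only
    constant factors and keeps [n2] positive. *)
Lemma inner_dimension_bounds (R : realType) (k : R) (n n2 M : nat) :
  (0 < k)%R -> (k < 1)%R -> 0 < n ->
  (`|n2%:R - n%:R `^ k| < 1)%R -> (`|M%:R - n%:R `^ (1 - k)| < 1)%R ->
  0 < n2 /\ path_len n2 M <= 10 * n.
Proof.
move=> k0 k1 n0; set x := (n%:R `^ k)%R; set y := (n%:R `^ (1 - k))%R.
have n1 : (1 <= n%:R :> R)%R by rewrite ler1n.
have x1 : (1 <= x)%R by rewrite -(powRr0 n%:R) ler_powR // ltW.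
have y1 : (1 <= y)%R by rewrite -(powRr0 n%:R) ler_powR // subr_ge0 ltW.
have xy : (x * y = n%:R)%R.
  rewrite -powRD; first by rewrite addrC subrK powRr1.
  by rewrite pnatr_eq0 -lt0n n0 implybT.
rewrite !ltr_norml => /andP[xl xu] /andP[yl yu]; split.
  by rewrite -(ltr0n R); lra.
rewrite -(ler_nat R) /path_len !natrM !natrD.
(* As [1 <= x] and [1 <= y], [n2 < x + 1 <= 2 * x] and [2 * M + 1 < 2 * y + 3 <= 5 * y]. *)
have : (n2%:R * (M%:R + M%:R + 1) <= (2 * x) * (5 * y))%R.
  by apply: ler_pM; rewrite ?addr_ge0 ?ler0n //; lra.
by rewrite -xy; lra.
Qed.

Theorem theorem10 (R : realType) (k : R) (k_gt0 : (0 < k)%R) (k_lt1 : (k < 1)%R) :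
  exists (build read : prog) (c : nat),
    forall (n n2 M : nat) (A : 'M[nat]_(n, n2)) (B : 'M[nat]_(n2, n)),
      0 < n ->
      (`|n2%:R - n%:R `^ k| < 1)%R ->
      (`|M%:R - n%:R `^ (1 - k)| < 1)%R ->
      entries_le M A -> entries_le M B ->
      exists (N : nat) (e : rel 'I_N) (C : 'M[nat]_(n, n)),
        [/\ N <= c * n,
            computes (word_bound c n) build
              (enc_minplus M A B) (enc_graph e) (c * n ^ 2),
            is_minplus A B C &
            computes (word_bound c n) read
              ([:: n; n2; n; M] ++ enc_apsp e) (enc_mx C) (c * n ^ 2)].
Proof.
(* The constant 2000 serves three purposes: 13 suffices for the vertices, 11 for the word length,
   and the running times determine its size. *)
exists build_graph, read_product, 2000 => n n2 M A B n_gt0 n2k Mk AM BM.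
have [n2_gt0 P_le] := inner_dimension_bounds k_gt0 k_lt1 n_gt0 n2k Mk.
have HW : 2 ^ 9 * n ^ 2 < word_bound 2000 n by exact: word_bound_gt.
have [C C_min] := minplus_exists A B n2_gt0.
exists (nverts n n2 M), (@edge_rel n n2 M
  (fun i k => nth 0 (enc_mx A) (i * n2 + k))
  (fun k j => nth 0 (enc_mx B) (k * n + j))), C; split=> //.
- by have := nverts_le n_gt0 n2_gt0 P_le; lia.
- exact: build_computes.
- exact: read_computes.
Qed.
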